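(* Let $n$ be the number of keys to be sorted and let $p$ be the number of CDF-based partitions, where each partition has roughly $\frac{n}{p}$ keys. Then the CDF-partitioned variation of bitonic sort described in the context needs $O(n)$ for the CDF-based partitioning, and then a total of $O\!\left(\tfrac{1}{2}\, n \left(\log \tfrac{n}{p}\right)\left(\log \tfrac{n}{p} + 1\right)\right)$ for the comparisons occurring in the first $\log \frac{n}{p}$ stages (which are within the same partition only), the remaining stages being skipped. So its total complexity is $$O\!\left(n + \tfrac{1}{2}\, n \left(\log \tfrac{n}{p}\right)\left(\log \tfrac{n}{p} + 1\right)\right) = O\!\left(n \log^2 \tfrac{n}{p}\right).$$
   Context: A CDF-based model is a learned approximation of the cumulative distribution function (CDF) of the keys; it assigns a key $x$ to the partition with index $CDF(x)\cdot p$, where $p$ is the number of partitions. The algorithm first uses such a model to divide the input keys into $p$ non-overlapping partitions that are relatively sorted (the partitions are in sorted order relative to one another, while keys inside a partition need not be sorted). It then applies a SIMD variation of bitonic sort, whose core is a bitonic sorting network, to each partition independently. A typical bitonic sorting network on $n$ keys proceeds in $\log n$ stages, stage $i$ consisting of $i$ steps of comparisons between pairs of keys; its total complexity is $O(n \log^2 n)$, which is basically the total number of comparisons, whether they are within the same partition or across partitions. Viewing the $n$ keys as split into $p$ partitions, the first $\log \frac{n}{p}$ stages execute completely locally (within the same partition). For a subsequent stage $\log \frac{n}{p} + k$, where $1 \le k \le \log p$, the first $k$ steps compare keys from different partitions, while the last $\log \frac{n}{p}$ steps are completely local. The algorithm skips all stages after the first $\log \frac{n}{p}$ because the partitions are already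 relatively sorted.
   Formalization: The formal statement assumes n ≥ 2p, i.e. log(n/p) ≥ 1, so at least one stage is executed; for n = p the final equality fails, since log(n/p) = 0 while partitioning still costs about n. *)

(* Defs.v *)
From mathcomp Require Import all_boot all_order all_algebra.
From mathcomp Require Import all_classical all_reals all_analysis.

Set Implicit Arguments.
Unset Strict Implicit.
Unset Printing Implicit Defensive.

Import Order.TTheory GRing.Theory Num.Theory.
Import numFieldNormedType.Exports.
Local Open Scope ring_scope.

(* A computation: its result and the number of elementary operations spent. *)
Definition counted (A : Type) : Type := (A * nat)%type.

Definition cbind (A B : Type) (m : counted A) (f : A -> counted B) : counted B :=
  let r := f m.1 in (r.1, (m.2 + r.2)%N).

Definition cfold (S A : Type) (f : S -> A -> counted S) (m : counted S)
    (s : seq A) : counted S :=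
  foldl (fun m a => cbind m (fun x => f x a)) m s.

Section Network.
Local Open Scope nat_scope.

(* The bitonic sorting network on N wires: stage i (from 1) merges sorted runs
   of 2^(i-1) wires into sorted runs of 2^i, in steps 1, ..., i; step t works
   inside aligned blocks of 2^(i-t+1) wires.  This is the form in which every
   comparator sends the smaller key to the lower wire: the first step of a stage
   pairs mirror images in a block instead of assuming that the second run is
   sorted downwards; the later steps are the usual half-cleaners.  If N is not a
   power of two, the comparators with a missing wire are dropped. *)
Definition comparator : Type := (nat * nat)%type.

Definition partner (i t l : nat) : nat :=
  let s := 2 ^ (i - t).+1 in
  if t == 1 then l %/ s * s + (s.-1 - l %% s) else l + s./2.

Definition bitonic_step (N i t : nat) : seq comparator :=
  let s := 2 ^ (i - t).+1 in
  [seq (l, partner i t l) | l <- iota 0 N & (l %% s < s./2) && (partner i t l < N)].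

Definition bitonic_stage (N i : nat) : seq (seq comparator) :=
  [seq bitonic_step N i t | t <- iota 1 i].

Definition bitonic_network (N : nat) : seq (seq (seq comparator)) :=
  [seq bitonic_stage N i | i <- iota 1 (up_log 2 N)].

(* p blocks of 2^b wires, one block per partition: the stages after the first b
   are skipped. *)
Definition executed_stages (p b : nat) : seq (seq (seq comparator)) :=
  take b (bitonic_network (p * 2 ^ b)).

Definition comparators (stages : seq (seq (seq comparator))) : seq comparator :=
  flatten (flatten stages).

End Network.

Section Algorithm.
Variables (R : realType) (d : Order.disp_t) (K : orderType d).

(* An empty slot None is a sentinel larger than every key. *)
Definition slot_lt (x y : option K) : bool :=
  match x, y with
  | Some a, Some b => (a < b)%O
  | Some _, None => true
  | None, _ => false
  end.

(* Every comparator costs 1, even if it meets empty slots. *)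
Definition compare_exchange (s : seq (option K)) (w : comparator) :
    counted (seq (option K)) :=
  let x := nth None s w.1 in
  let y := nth None s w.2 in
  (if slot_lt y x then set_nth None (set_nth None s w.1 y) w.2 x else s, 1%N).

Definition run_comparators (ws : seq comparator) (s : seq (option K)) :
    counted (seq (option K)) :=
  cfold compare_exchange (s, 0%N) ws.

(* The partition CDF(x) * p, rounded down, where CDF(x) = 1 goes to the last
   partition. *)
Definition cdf_index (F : K -> R) (p : nat) (x : K) : nat :=
  minn (Num.truncn (F x * p%:R)) p.-1.

(* One evaluation of the model and one write. *)
Definition bucket_insert (F : K -> R) (p : nat) (B : seq (seq K)) (x : K) :
    counted (seq (seq K)) :=
  let j := cdf_index F p x in
  (set_nth [::] B j (rcons (nth [::] B j) x), 2%N).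

(* log of the common block width: the least b such that every partition fits in
   2^b slots. *)
Definition block_log (B : seq (seq K)) : nat :=
  up_log 2 (\max_(b <- B) size b)%N.

(* Partition j is laid out, padded with empty slots, on the wires
   j * 2^b, ..., (j + 1) * 2^b - 1.  Finding b costs one operation per partition,
   the layout one per slot. *)
Definition layout (B : seq (seq K)) : counted (nat * seq (option K)) :=
  let b := block_log B in
  ((b, flatten [seq [seq Some x | x <- s] ++ nseq (2 ^ b - size s) None | s <- B]),
   (size B + size B * 2 ^ b)%N).

(* Creating the p empty partitions costs p. *)
Definition cdf_partition (F : K -> R) (p : nat) (s : seq K) :
    counted (nat * seq (option K)) :=
  cbind (cfold (bucket_insert F p) (nseq p [::], p) s) layout.

(* The final removal of the empty slots is charged one operation per slot. *)
Definition cdf_bitonic_sort (F : K -> R) (p : nat) (s : seq K) : counted (seq K) :=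
  cbind (cdf_partition F p s) (fun bA =>
  cbind (run_comparators (comparators (executed_stages p bA.1)) bA.2) (fun A =>
  (pmap id A, size A))).

(* An input: n keys, p partitions and a model, such that
   - every partition has roughly n / p keys, i.e. n / p up to the factor c;
   - 2 p <= n, i.e. log (n / p) >= 1, so that there is a stage to execute
     (for n = p, log (n / p) = 0 and n is not O(n log^2 (n / p))). *)
Record cdf_input (c : R) := CdfInput {
  keys : seq K;
  nparts : nat;
  model : K -> R;
  model_range : forall x, 0 <= model x <= 1;
  model_mono : {homo model : x y / (x <= y)%O >-> x <= y};
  nparts_gt0 : (0 < nparts)%N;
  nparts_le : (2 * nparts <= size keys)%N;
  balanced : forall j, (j < nparts)%N ->
    (size keys)%:R / nparts%:R / c
      <= (count (fun x => cdf_index model nparts x == j) keys)%:R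
      <= c * ((size keys)%:R / nparts%:R)
}.

Section Costs.
Variables (c : R) (I : cdf_input c).

Definition nkeys : nat := size (keys I).

Definition partitioned : counted (nat * seq (option K)) :=
  cdf_partition (model I) (nparts I) (keys I).

Definition nstages : nat := partitioned.1.1.

Definition executed : seq comparator :=
  comparators (executed_stages (nparts I) nstages).

(* Wires belong to the same partition iff they lie in the same block. *)
Definition same_partition (w : comparator) : Prop :=
  (w.1 %/ 2 ^ nstages = w.2 %/ 2 ^ nstages)%N.

Definition partition_cost : nat := partitioned.2.

Definition comparison_cost : nat := (run_comparators executed partitioned.1.2).2.

Definition total_cost : nat :=
  (cdf_bitonic_sort (model I) (nparts I) (keys I)).2.

End Costs.
End Algorithm.

Definition log2 (R : realType) (x : R) : R := ln x / ln 2.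

Definition log_ratio (R : realType) (d : Order.disp_t) (K : orderType d) (c : R)
    (I : cdf_input K c) : R :=
  log2 ((nkeys I)%:R / (nparts I)%:R).

(* Main.v *)
Require Import Defs.
From mathcomp Require Import all_boot all_order all_algebra.
From mathcomp Require Import all_classical all_reals all_analysis.
From mathcomp Require Import zify ring lra.
Import Order.TTheory GRing.Theory Num.Theory.
Import numFieldNormedType.Exports.
Local Open Scope classical_set_scope.
Local Open Scope ring_scope.

(* Write r = n / p >= 2, L = log2 r >= 1 and M for the size of the largest
   partition.  Counting the keys gives r <= M, and balance gives M <= c r; since
   2^(b-1) < M <= 2^b, the number b of executed stages satisfies
   L <= b <= L + log2 c + 1 <= (log2 c + 2) L, and there are N = p 2^b <= 2 c n
   wires.  Partitioning costs 2 p + 2 n + N, and the first b stages have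
   b (b + 1) / 2 steps of at most N comparators each.  Their steps work inside
   aligned blocks of at most 2^b wires, hence inside the partitions. *)

(** * Comparators of the bitonic network: locality and number *)

Section Network.
Local Open Scope nat_scope.

(** Both kinds of partner keep the block: a mirror image has offset [s.-1 - l %% s], and a shift by
    [s./2] starts from an offset below [s./2]. *)
Lemma mem_bitonic_step (N i t : nat) (w : comparator) :
  w \in bitonic_step N i t ->
  [/\ w.1 < N, w.2 < N & w.1 %/ 2 ^ (i - t).+1 = w.2 %/ 2 ^ (i - t).+1].
Proof.
case/mapP=> l; rewrite mem_filter mem_iota add0n => /andP[/andP[low wN] lN] -> /=.
split=> //; move: low; rewrite /partner.
set s := 2 ^ (i - t).+1; have s_gt0 : 0 < s by rewrite expn_gt0.
have half_le : s./2 + s./2 <= s by rewrite addnn -[leqRHS]odd_double_half leq_addl.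
move=> low; case: ifP => _.
  rewrite divnMDl // [(_ - _) %/ _]divn_small ?addn0 //.
  by rewrite (leq_ltn_trans (leq_subr _ _)) // prednK.
rewrite {2}(divn_eq l s) -addnA divnMDl // [(_ + _) %/ _]divn_small ?addn0 //.
by rewrite (leq_trans _ half_le) // ltn_add2r.
Qed.

(** Since [i <= b] and [t >= 1], the block width [2 ^ (i - t).+1] of a step divides [2 ^ b]. *)
Lemma mem_executed_stages (p b : nat) (w : comparator) :
  w \in comparators (executed_stages p b) ->
  [/\ w.1 < p * 2 ^ b, w.2 < p * 2 ^ b & w.1 %/ 2 ^ b = w.2 %/ 2 ^ b].
Proof.
case/flattenP=> step /flattenP[stage].
rewrite /executed_stages /bitonic_network -map_take take_iota.
case/mapP=> i; rewrite mem_iota add1n ltnS leq_min => /andP[i_gt0 /andP[le_ib _]] ->.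
case/mapP=> t; rewrite mem_iota => /andP[t_gt0 _] ->.
case/mem_bitonic_step => w1N w2N same_block; split=> //.
have le_b : (i - t).+1 <= b by lia.
by rewrite -(subnKC le_b) expnD !divnMA same_block.
Qed.

Lemma size_bitonic_step (N i t : nat) : size (bitonic_step N i t) <= N.
Proof. by rewrite size_map size_filter (leq_trans (count_size _ _)) ?size_iota. Qed.

Lemma size_flatten_le (T : Type) (m : nat) (ss : seq (seq T)) :
  all (fun s => size s <= m) ss -> size (flatten ss) <= size ss * m.
Proof.
elim: ss => //= s ss IHss /andP[s_le ss_le].
by rewrite size_cat mulSn leq_add // IHss.
Qed.

(** Stage [i] has [i] steps of at most [N] comparators, and the sum of [i] up to [b] is
    ['C(b.+1, 2)]. *)
Lemma size_executed_stages (p b : nat) :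
  size (comparators (executed_stages p b)) <= 'C(b.+1, 2) * (p * 2 ^ b).
Proof.
rewrite /executed_stages; set N := p * 2 ^ b.
rewrite /comparators /bitonic_network -map_take take_iota.
(* The full network has [up_log 2 N] stages, so [take] keeps the minimum of this and [b]; only
   [m <= b] matters for the bound. *)
set m := minn _ _.
have le_mb : m <= b by rewrite geq_minl.
apply: leq_trans (_ : 'C(m.+1, 2) * N <= _); last first.
  by rewrite leq_mul2r !bin2 half_leq ?orbT // leq_mul.
rewrite -bin2_sum big_ltn // add0n big_distrl /= /index_iota subSS subn0.
elim: (iota 1 m) => [|i s IHs] /=; first by rewrite big_nil.
rewrite flatten_cat size_cat big_cons leq_add //.
rewrite (leq_trans (@size_flatten_le _ N _ _)) ?size_map ?size_iota //.
by apply/allP => _ /mapP[t _ ->]; apply: size_bitonic_step.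
Qed.

End Network.

(** * Result and cost of a counted fold *)

Section CountedFold.
Context {S A : Type} (f : S -> A -> counted S).

Lemma cfold_result (m : counted S) (s : seq A) :
  (cfold f m s).1 = foldl (fun x a => (f x a).1) m.1 s.
Proof. by rewrite /cfold; elim: s m => //= a s IHs m; rewrite IHs. Qed.

Lemma cfold_cost (k : nat) (m : counted S) (s : seq A) :
  (forall x a, (f x a).2 = k) -> (cfold f m s).2 = (m.2 + k * size s)%N.
Proof.
move=> f_cost; rewrite /cfold; elim: s m => [|a s IHs] m /=; first by lia.
by rewrite IHs /= f_cost; lia.
Qed.

End CountedFold.

(** * Sizes of the partitions and of the array of slots *)

Section Partitioning.
Local Open Scope nat_scope.
Context {R : realType} {d : Order.disp_t} {K : orderType d}.
Implicit Types (s : seq K) (B : seq (seq K)).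

Lemma cdf_index_lt (F : K -> R) (p : nat) (x : K) :
  0 < p -> cdf_index F p x < p.
Proof. by rewrite /cdf_index; lia. Qed.

Lemma size_bucket_insert_foldl (F : K -> R) (p : nat) s B :
  0 < p -> size B = p ->
  let B' := foldl (fun B x => (bucket_insert F p B x).1) B s in
  size B' = p /\ forall j, size (nth [::] B' j) =
    size (nth [::] B j) + count (fun x => cdf_index F p x == j) s.
Proof.
move=> p_gt0; elim: s B => [|x s IHs] B sizeB /=; first by split=> // j; rewrite addn0.
have [|-> bucket_size] := IHs (set_nth [::] B (cdf_index F p x)
  (rcons (nth [::] B (cdf_index F p x)) x)).
  (* The index is below [p], so [set_nth] does not lengthen the list. *)
  by rewrite size_set_nth sizeB; apply/maxn_idPr; apply: cdf_index_lt.
split=> // j; rewrite bucket_size nth_set_nth /= eq_sym.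
by case: eqP => [->|_]; rewrite ?size_rcons; lia.
Qed.

Lemma sum_count_fibers (T : Type) (f : T -> nat) (p : nat) (s : seq T) :
  (forall x, f x < p) -> \sum_(j < p) count (fun x => f x == j) s = size s.
Proof.
move=> f_lt; rewrite -sum1_size (partition_big (fun x => Ordinal (f_lt x)) predT) //=.
by apply: eq_bigr => j _; rewrite sum1_count.
Qed.

(** By the choice of [block_log], the truncated subtraction that counts the padding is exact. *)
Lemma size_layout B :
  size (layout B).1.2 = size B * 2 ^ block_log B.
Proof.
have fits b : b \in B -> size b <= 2 ^ block_log B.
  by move=> bB; apply: leq_trans (up_logP _ _) => //; apply: leq_bigmax_seq.
rewrite /layout /= size_flatten /shape -map_comp sumnE big_map big_seq.
rewrite (eq_bigr (fun=> 2 ^ block_log B)) => [|b /fits b_le].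
  by rewrite -big_seq big_const_seq count_predT iter_addn_0 mulnC.
by rewrite /= size_cat size_map size_nseq subnKC.
Qed.

(** Wires out of range would make [set_nth] extend the array, and the final removal is charged by
    its size. *)
Lemma size_run_comparators (A : seq (option K)) (ws : seq comparator) :
  (forall w, w \in ws -> w.1 < size A /\ w.2 < size A) ->
  size (run_comparators ws A).1 = size A.
Proof.
rewrite /run_comparators cfold_result /=.
elim: ws A => //= w ws IHws A inA.
have [w1A w2A] := inA w (mem_head _ _).
have sizeA : size (compare_exchange A w).1 = size A.
  by rewrite /compare_exchange; case: ifP => //= _; rewrite !size_set_nth; lia.
rewrite IHws ?sizeA // => v vws.
by apply: inA; rewrite in_cons vws orbT.
Qed.

End Partitioning.

(** * From pointwise bounds to O *)

Section BigO.
Context {R : numFieldType} {T : Type} {V W U : normedModType R}.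
Variable F : filter_on T.

Lemma eqO_of_le (f : T -> V) (g : T -> W) (C : R) :
  0 < C -> (forall x, `|f x| <= C * `|g x|) -> f =O_F g.
Proof.
by move=> C_gt0 fg; apply/eqO_exP; exists C => //; apply: nearW.
Qed.

Lemma eqO_le_trans (f : T -> V) (g : T -> W) (h : T -> U) (C : R) :
  0 < C -> (forall x, `|g x| <= C * `|h x|) -> f =O_F g -> f =O_F h.
Proof.
move=> C_gt0 gh /eqO_exP[k k_gt0 fg]; apply/eqO_exP.
exists (k * C); first exact: mulr_gt0.
by apply: filterS fg => x /le_trans; apply; rewrite -mulrA ler_wpM2l ?gh ?ltW.
Qed.

End BigO.

(** * Base-two logarithm *)

Section Log2.
Context {R : realType}.
Implicit Types x y : R.

Let ln2_gt0 : 0 < ln 2 :> R.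
Proof. by rewrite ln_gt0 ?ltr1n. Qed.

Lemma ler_log2 x y : 0 < x -> x <= y -> log2 x <= log2 y.
Proof.
move=> x_gt0 le_xy; rewrite /log2 ler_pM2r ?invr_gt0 //.
by rewrite ler_ln ?posrE ?(lt_le_trans x_gt0).
Qed.

Lemma log2M x y : 0 < x -> 0 < y -> log2 (x * y) = log2 x + log2 y.
Proof. by move=> x_gt0 y_gt0; rewrite /log2 lnM ?posrE // mulrDl. Qed.

Lemma log2_exp2 (b : nat) : log2 (2 ^ b)%:R = b%:R :> R.
Proof. by rewrite /log2 natrX lnXn ?ltr0n // -[_ *+ b]mulr_natl mulfK ?gt_eqF. Qed.

Lemma log2_2 : log2 2 = 1 :> R.
Proof. by rewrite /log2 divff ?gt_eqF. Qed.

End Log2.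

Lemma natr_bin2 (R : realFieldType) (b : nat) :
  'C(b.+1, 2)%:R = 2^-1 * b%:R * (b%:R + 1) :> R.
Proof.
have /(congr1 (fun m => m%:R : R)) : ('C(b.+1, 2) * 2 = b.+1 * b)%N.
  by rewrite (bin_ffact b.+1 2) ffactnS ffactn1.
by rewrite natrM [RHS]natrM -[b.+1%:R]natr1; lra.
Qed.

(** * Stage count and costs for a single input *)

Section Input.
Context {R : realType} {d : Order.disp_t} {K : orderType d} {c : R}.
Variable I : cdf_input K c.

Let n : nat := nkeys I.
Let p : nat := nparts I.
Let b : nat := nstages I.
Let r : R := n%:R / p%:R.
Let L : R := log_ratio I.

Let buckets : seq (seq K) :=
  (cfold (bucket_insert (model I) p) (nseq p [::], p) (keys I)).1.

Let p_gt0 : (0 < p)%N. Proof. exact: nparts_gt0. Qed.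

Let size_buckets : size buckets = p.
Proof.
rewrite /buckets cfold_result.
have sizeB0 := size_nseq p ([::] : seq K).
by case: (size_bucket_insert_foldl (model I) p (keys I) _ p_gt0 sizeB0).
Qed.

Let size_bucket (j : nat) : size (nth [::] buckets j) =
  count (fun x => cdf_index (model I) p x == j) (keys I).
Proof.
rewrite /buckets cfold_result.
have sizeB0 := size_nseq p ([::] : seq K).
have [_ ->] := size_bucket_insert_foldl (model I) p (keys I) _ p_gt0 sizeB0.
by rewrite nth_nseq if_same.
Qed.

Let M : nat := (\max_(s <- buckets) size s)%N.

(** Pigeonhole: the [p] fibers of the index map partition the keys. *)
Let max_bucket_ge : (n <= p * M)%N.
Proof.
rewrite /n /nkeys -(@sum_count_fibers _ (cdf_index (model I) p) p) => [|x]; last first.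
  exact: cdf_index_lt.
rewrite -[p in (p * _)%N]card_ord -sum_nat_const; apply: leq_sum => j _.
by rewrite -size_bucket; apply: leq_bigmax_seq; rewrite ?mem_nth ?size_buckets.
Qed.

(** For [M <= 1] the logarithm [b] would be 0 and [2 ^ b.-1 < M] would fail. *)
Let max_bucket_gt1 : (1 < M)%N.
Proof.
by have := nparts_le I; move: max_bucket_ge p_gt0; rewrite /n /nkeys -/p; nia.
Qed.

Let ratio_ge2 : 2 <= r.
Proof.
by rewrite ler_pdivlMr ?ltr0n // -natrM ler_nat; apply: nparts_le.
Qed.

Let max_bucket_le : 1 <= c -> M%:R <= c * r.
Proof.
move=> c_ge1; rewrite /M (big_nth [::]) big_mkord size_buckets.
apply: (big_ind (fun m => m%:R <= c * r)).
- by have := ratio_ge2; nra.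
- by move=> x y xr yr; rewrite /maxn; case: ifP.
- by move=> j _; rewrite size_bucket; have /andP[] := @balanced _ _ _ _ I _ (ltn_ord j).
Qed.

Lemma log_ratio_ge1 : 1 <= L.
Proof.
by rewrite -log2_2 ler_log2.
Qed.

Let two_power_bounds : (2 ^ b.-1 < M <= 2 ^ b)%N.
Proof. exact: (@up_log_bounds 2 M). Qed.

Let b_gt0 : (0 < b)%N.
Proof. by move: two_power_bounds max_bucket_gt1; case: b => //=; lia. Qed.

Let block_le : 1 <= c -> (2 ^ b)%:R <= 2 * (c * r).
Proof.
move=> c_ge1; have /andP[lt_M _] := two_power_bounds.
have := max_bucket_le c_ge1; rewrite -(prednK b_gt0) expnS natrM.
by move: lt_M; rewrite -(ltr_nat R); lra.
Qed.

Lemma nstages_bounds : 1 <= c -> L <= b%:R <= L + log2 c + 1.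
Proof.
move=> c_ge1; have r_gt0 : 0 < r by have := ratio_ge2; lra.
have c_gt0 : 0 < c by lra.
rewrite (_ : L = log2 r) // -(log2_exp2 b) -[X in _ + X]log2_2; apply/andP; split.
  (* Lower bound: [n <= p * M <= p * 2 ^ b]. *)
  apply: ler_log2 => //; rewrite ler_pdivrMr ?ltr0n // -natrM ler_nat mulnC.
  apply: leq_trans max_bucket_ge _; rewrite leq_mul2l.
  by case/andP: two_power_bounds => _ ->; rewrite orbT.
have rc_gt0 : 0 < r * c by apply: mulr_gt0.
rewrite -!log2M // ler_log2 ?ltr0n ?expn_gt0 //.
by have := block_le c_ge1; lra.
Qed.

Lemma wires_le : 1 <= c -> (p * 2 ^ b)%:R <= 2 * c * n%:R.
Proof.
move=> /block_le; have p_gt0R : 0 < p%:R :> R by rewrite ltr0n.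
rewrite -(ler_pM2l p_gt0R) natrM => /le_trans; apply.
by rewrite /r le_eqVlt; apply/orP; left; apply/eqP; field; lra.
Qed.

(** One [p] pays for creating the partitions, the other for finding [b]; each key costs 2, each slot
    1. *)
Lemma partition_costE : partition_cost I = (2 * p + 2 * n + p * 2 ^ b)%N.
Proof.
rewrite /partition_cost /partitioned /cdf_partition /= (@cfold_cost _ _ _ 2) //= -/p.
by rewrite -/buckets size_buckets (_ : block_log buckets = b) // /n /nkeys; lia.
Qed.

Lemma comparison_cost_le :
  (comparison_cost I <= 'C(b.+1, 2) * (p * 2 ^ b))%N.
Proof.
rewrite /comparison_cost /run_comparators (@cfold_cost _ _ _ 1) //= mul1n.
exact: size_executed_stages.
Qed.

Lemma executed_same_partition (w : comparator) :
  w \in executed I -> same_partition I w.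
Proof. by case/mem_executed_stages. Qed.

(** The last term is the removal of empty slots, since comparators preserve the array size. *)
Lemma total_costE :
  total_cost I = (partition_cost I + comparison_cost I + p * 2 ^ b)%N.
Proof.
have sizeA : size (partitioned I).1.2 = (p * 2 ^ b)%N.
  by rewrite [LHS]size_layout -/buckets size_buckets.
rewrite -[in RHS]sizeA -(@size_run_comparators _ _ (partitioned I).1.2 (executed I)).
  by rewrite -addnA.
by move=> w /mem_executed_stages[w1 w2 _]; rewrite sizeA.
Qed.

Lemma partition_cost_le : 1 <= c -> (partition_cost I)%:R <= (3 + 2 * c) * n%:R.
Proof.
move=> /wires_le; rewrite partition_costE 2!natrD.
have : (2 * p)%:R <= n%:R :> R by rewrite ler_nat; apply: nparts_le.
by rewrite (natrM _ 2 n); lra.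
Qed.

Lemma comparison_cost_bound : 1 <= c ->
  (comparison_cost I)%:R <=
    2 * c * (log2 c + 2) ^+ 2 * (2^-1 * n%:R * L * (L + 1)).
Proof.
move=> c_ge1; have L_ge1 := log_ratio_ge1.
have log2c_ge0 : 0 <= log2 c.
  by rewrite divr_ge0 ?ln_ge0 ?ler1n.
have /andP[_ b_le] := nstages_bounds c_ge1.
have le_cost : (comparison_cost I)%:R <=
    (2^-1 * b%:R * (b%:R + 1)) * (p * 2 ^ b)%:R :> R.
  by rewrite -natr_bin2 -natrM ler_nat comparison_cost_le.
apply: (le_trans le_cost).
have -> : 2 * c * (log2 c + 2) ^+ 2 * (2^-1 * n%:R * L * (L + 1)) =
    (2^-1 * ((log2 c + 2) * L) * ((log2 c + 2) * (L + 1))) * (2 * c * n%:R) by ring.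
have b_ge0 : 0 <= b%:R :> R by [].
(* Here [L >= 1] turns the additive error [log2 c + 1] on [b] into the factor [log2 c + 2], used
   once for [b] and once for [b + 1]. *)
have prod_ge0 : 0 <= log2 c * (L - 1) by rewrite mulr_ge0 ?subr_ge0.
have b_le1 : b%:R <= (log2 c + 2) * L by lra.
have b_le2 : b%:R + 1 <= (log2 c + 2) * (L + 1) by lra.
have half_ge0 : 0 <= 2^-1 :> R by rewrite invr_ge0.
by rewrite ler_pM ?wires_le ?mulr_ge0 ?addr_ge0 // !ler_pM ?mulr_ge0.
Qed.

Lemma comparison_bound_ge0 : 0 <= 2^-1 * n%:R * L * (L + 1).
Proof.
have L_ge0 : 0 <= L by exact: le_trans ler01 log_ratio_ge1.
by do ![apply: mulr_ge0 => // | apply: addr_ge0 => //]; rewrite ?invr_ge0.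
Qed.

(** Of [3 + 4 * c], partitioning takes [3 + 2 * c] and the final removal [2 * c]. *)
Lemma total_cost_bound : 1 <= c ->
  (total_cost I)%:R <= (3 + 4 * c + 2 * c * (log2 c + 2) ^+ 2) *
    (n%:R + 2^-1 * n%:R * L * (L + 1)).
Proof.
move=> c_ge1; rewrite total_costE 2!natrD.
have := partition_cost_le c_ge1; have := comparison_cost_bound c_ge1.
have := wires_le c_ge1.
have k_ge0 : 0 <= 2 * c * (log2 c + 2) ^+ 2.
  by rewrite mulr_ge0 ?sqr_ge0 //; lra.
have := mulr_ge0 k_ge0 (ler0n R n).
have c4_ge0 : 0 <= 3 + 4 * c by lra.
have := mulr_ge0 c4_ge0 comparison_bound_ge0.
set k := 2 * c * _; set q := 2^-1 * _ * _ * _; lra.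
Qed.

Lemma total_bound_le_final :
  n%:R + 2^-1 * n%:R * L * (L + 1) <= 2 * (n%:R * L ^+ 2).
Proof.
(* The quadratic factors as [(3 * L + 2) * (L - 1)]; this is where [L >= 1] absorbs the linear term
   [n]. *)
have quad_ge0 : 0 <= 4 * L ^+ 2 - 2 - L * (L + 1) by have := log_ratio_ge1; nra.
by have := mulr_ge0 (ler0n R n) quad_ge0; lra.
Qed.

Lemma final_bound_le_total :
  n%:R * L ^+ 2 <= 2 * (n%:R + 2^-1 * n%:R * L * (L + 1)).
Proof.
have L_ge0 : 0 <= L by exact: le_trans ler01 log_ratio_ge1.
by have := mulr_ge0 (ler0n R n) L_ge0; have := ler0n R n; lra.
Qed.

End Input.

(** The filter [uniformly] contains only the full set, so each O is a bound on all inputs at once;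
    the constants supplied depend on [c] alone. *)
Theorem mainTheorem3 (R : realType) (d : Order.disp_t) (K : orderType d)
    (c : R) (hc : 1 <= c) :
  let uniformly := FilterType (globally [set: cdf_input K c]) _ in
  let n : cdf_input K c -> R^o := fun I => (nkeys I)%:R in
  let L : cdf_input K c -> R^o := fun I => log_ratio I in
  let comparisons_bound : cdf_input K c -> R^o :=
    fun I => 2^-1 * n I * L I * (L I + 1) in
  let total_bound : cdf_input K c -> R^o :=
    fun I => n I + 2^-1 * n I * L I * (L I + 1) in
  let final_bound : cdf_input K c -> R^o := fun I => n I * L I ^+ 2 in
  ((fun I => (partition_cost I)%:R : R^o) =O_uniformly n) /\
  (forall I : cdf_input K c, L I <= (nstages I)%:R <= L I + log2 c + 1) /\
  (forall (I : cdf_input K c) (w : comparator),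
     w \in executed I -> same_partition I w) /\
  ((fun I => (comparison_cost I)%:R : R^o) =O_uniformly comparisons_bound) /\
  ((fun I => (total_cost I)%:R : R^o) =O_uniformly total_bound) /\
  (forall f : cdf_input K c -> R^o,
     (f =O_uniformly total_bound) <-> (f =O_uniformly final_bound)) /\
  ((fun I => (total_cost I)%:R : R^o) =O_uniformly final_bound).
Proof.
move=> uniformly n L comparisons_bound total_bound final_bound.
have comparisons_ge0 I : 0 <= comparisons_bound I := comparison_bound_ge0 I.
have total_ge0 I : 0 <= total_bound I.
  by apply: addr_ge0; [exact: ler0n|exact: comparisons_ge0].
have final_ge0 I : 0 <= final_bound I by apply: mulr_ge0; [exact: ler0n|exact: sqr_ge0].
(* Equality of the two O classes: each bound is at most twice the other. *)
have total_final (f : cdf_input K c -> R^o) :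
    (f =O_uniformly total_bound) <-> (f =O_uniformly final_bound).
  split; apply: (@eqO_le_trans _ _ _ _ _ _ _ _ _ 2) => // I; rewrite !ger0_norm //.
    exact: total_bound_le_final.
  exact: final_bound_le_total.
have c_gt0 : 0 < c by exact: lt_le_trans hc.
have k_ge0 : 0 <= 2 * c * (log2 c + 2) ^+ 2.
  by rewrite mulr_ge0 ?sqr_ge0 //; lra.
have totalO : (fun I => (total_cost I)%:R : R^o) =O_uniformly total_bound.
  apply: (@eqO_of_le _ _ _ _ _ _ _ (3 + 4 * c + 2 * c * (log2 c + 2) ^+ 2)).
    by lra.
  by move=> I; rewrite !ger0_norm //; apply: total_cost_bound.
split; last split; last split; last split; last split; last split => //.
- apply: (@eqO_of_le _ _ _ _ _ _ _ (3 + 2 * c)) => [|I]; first by lra.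
  by rewrite !ger0_norm //; apply: partition_cost_le.
- by move=> I; apply: nstages_bounds.
- exact: executed_same_partition.
(* The added 1 makes the constant positive directly from [k_ge0]. *)
- apply: (@eqO_of_le _ _ _ _ _ _ _ (2 * c * (log2 c + 2) ^+ 2 + 1)) => [|I].
    by lra.
  rewrite !ger0_norm //; apply: le_trans (comparison_cost_bound I hc) _.
  by apply: ler_wpM2r; [exact: comparisons_ge0|lra].
- exact: totalO.
- by apply/total_final.
Qed.
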